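(* Let $\Omega\subset\mathbb{R}^d$, $d\in\{2,3\}$, be a bounded domain, $Re>0$ and $\gamma>0$ fixed parameters. Suppose $\mathbf{u}_0\in \mathbf{H}^1_0(\Omega)$ with $\nabla\cdot\mathbf{u}_0=0$, and $\mathbf{F}\in \mathbf{L}^\infty(0,\infty;\mathbf{L}^2(\Omega))$. For a time step $k>0$, let $(\mathbf{u}^{n},p^{n},q^{n})_{n}$ be generated, with no-slip boundary condition $\mathbf{u}^{n}=0$ on $\partial\Omega$, by the BDF2-SAV scheme: for $n\ge 1$, $$\frac{3\mathbf{u}^{n+1}-4\mathbf{u}^n+\mathbf{u}^{n-1}}{2k}-\frac{1}{Re}\Delta\mathbf{u}^{n+1}+q^{n+1}\big(\overline{\mathbf{u}}^{n+1}\cdot\nabla\big)\overline{\mathbf{u}}^{n+1}+\nabla p^{n+1}=\mathbf{F}^{n+1},\qquad \nabla\cdot\mathbf{u}^{n+1}=0,$$ $$\frac{3q^{n+1}-4q^n+q^{n-1}}{2k}+\gamma q^{n+1}-\int_\Omega\big(\overline{\mathbf{u}}^{n+1}\cdot\nabla\big)\overline{\mathbf{u}}^{n+1}\cdot\mathbf{u}^{n+1}\,dx=\gamma,$$ where $\overline{\mathbf{u}}^{n+1}:=2\mathbf{u}^n-\mathbf{u}^{n-1}$, and initiated by $\mathbf{u}^0=\mathbf{u}_0$, $q^0=1$, with $(\mathbf{u}^1,p^1,q^1)$ computed by the first-order counterpart of the scheme (given in the context). Then for any $k>0$ the scheme is long-time stable in the sense that $$\|\mathbf{u}^n\|+|q^n|\le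 C\qquad\text{for all } n\ge 2,$$ where $C$ is a constant (independent of $n$ and $k$) depending on $\|\mathbf{u}_0\|_{H^1}$ and $\|\mathbf{F}\|_{L^\infty(0,\infty;L^2(\Omega))}$ (and on the fixed data $\Omega$, $Re$, $\gamma$).
   Context: $\|\cdot\|$ denotes the $L^2(\Omega)$ norm. Time levels are $t^n=nk$ and $\mathbf{F}^{n}=\mathbf{F}(t^{n})$; $\mathbf{F}$ is taken to be defined at every time with $\|\mathbf{F}(t)\|\le\|\mathbf{F}\|_{L^\infty(0,\infty;L^2(\Omega))}$. The momentum equation is understood in the weak sense, with $\mathbf{u}^{n}\in\mathbf{H}^1_0(\Omega)$. The scheme discretizes the incompressible Navier–Stokes equations $\partial_t\mathbf{u}+\mathbf{u}\cdot\nabla\mathbf{u}-\frac1{Re}\Delta\mathbf{u}=-\nabla p+\mathbf{F}$, $\nabla\cdot\mathbf{u}=0$, augmented with a scalar auxiliary variable $q(t)\equiv 1$. The Poincaré inequality $\|\nabla\mathbf{v}\|^2\ge c_0\|\mathbf{v}\|^2$, $c_0>0$, holds for $\mathbf{v}\in\mathbf{H}^1_0(\Omega)$. First-order counterpart used for the first step: $$\frac{\mathbf{u}^{1}-\mathbf{u}^0}{k}-\frac1{Re}\Delta\mathbf{u}^{1}+q^{1}(\mathbf{u}^0\cdot\nabla)\mathbf{u}^0+\nabla p^{1}=\mathbf{F}^{1},\quad \nabla\cdot\mathbf{u}^{1}=0,\quad \mathbf{u}^1|_{\partial\Omega}=0,$$ $$\frac{q^{1}-q^0}{k}+\gamma q^{1}-\int_\Omega(\mathbf{u}^0\cdot\nabla)\mathbf{u}^0\cdot\mathbf{u}^{1}\,dx=\gamma.$$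 *)

(* Defs.v *)
From HB Require Import structures.
From mathcomp Require Import all_boot all_order all_algebra.
From mathcomp Require Import all_classical all_reals all_analysis.

Set Implicit Arguments.
Unset Strict Implicit.
Unset Printing Implicit Defensive.

Import Order.TTheory GRing.Theory Num.Theory.
Import numFieldNormedType.Exports.

Local Open Scope classical_set_scope.
Local Open Scope ring_scope.

Section measurable_rV.
Context {R : realType}.
Variable n : nat.

Let coors : 'I_n -> 'rV[R]_n -> R := fun i x => x ord0 i.

Let rV_set0 : g_sigma_preimage coors set0.
Proof. exact: sigma_algebra0. Qed.

Let rV_setC A : g_sigma_preimage coors A -> g_sigma_preimage coors (~` A).
Proof. exact: sigma_algebraC. Qed.

Let rV_bigcup (F : _^nat) : (forall i, g_sigma_preimage coors (F i)) ->
  g_sigma_preimage coors (\bigcup_i (F i)).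
Proof. exact: sigma_algebra_bigcup. Qed.

(* Generated by the coordinates, as the library does for tuples; this is the
   Borel sigma-algebra of R^n. *)
HB.instance Definition _ := @isMeasurable.Build
  (measure_tuple_display default_measure_display) 'rV[R]_n
  (g_sigma_preimage coors) rV_set0 rV_setC rV_bigcup.

Lemma measurable_rV_coor (i : 'I_n) :
  measurable_fun [set: 'rV[R]_n] (fun x : 'rV[R]_n => x ord0 i).
Proof.
move=> _ Y mY; rewrite setTI; apply: sub_sigma_algebra => /=.
rewrite -bigcup_seq/=; exists i => /=; first by rewrite mem_index_enum.
by exists Y => //; rewrite setTI.
Qed.

Lemma measurable_fun_rVP d (T : measurableType d) (f : T -> 'rV[R]_n) :
  (forall i, measurable_fun [set: T] (fun x => f x ord0 i)) ->
  measurable_fun [set: T] f.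
Proof.
move=> mf.
suff H : measurable `<=` [set B | measurable (f @^-1` B)].
  by move=> _ B mB; rewrite setTI; exact: H.
apply: smallest_sub.
  split => /=; first by rewrite preimage_set0.
    by move=> A mA; rewrite setTD preimage_setC; exact: measurableC.
  by move=> F mF; rewrite preimage_bigcup; exact: bigcup_measurable.
rewrite -bigcup_seq => B [i _ [C mC <-]] /=; rewrite setTI -comp_preimage.
by rewrite -[X in measurable X]setTI; exact: mf.
Qed.

End measurable_rV.

Section lebesgue_rV_succ.
Context {R : realType} (n : nat).
Variable mu : {sigma_finite_measure set 'rV[R]_n -> \bar R}.

Definition cons_rV (z : measurableTypeR R * 'rV[R]_n) : 'rV[R]_n.+1 :=
  row_mx (z.1)%:M z.2.

Definition behead_rV (x : 'rV[R]_n.+1) : measurableTypeR R * 'rV[R]_n :=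
  (x ord0 ord0, @rsubmx _ 1 1 n x).

Let cons_rV0 z : cons_rV z ord0 ord0 = z.1.
Proof.
rewrite /cons_rV mxE; case: splitP => [j|[]//].
by rewrite ord1 mxE eqxx mulr1n.
Qed.

Let cons_rVS z i : cons_rV z ord0 (lift ord0 i) = z.2 ord0 i.
Proof.
have -> : lift ord0 i = rshift 1 i :> 'I_n.+1 by apply/val_inj.
exact: row_mxEr.
Qed.

Lemma measurable_cons_rV : measurable_fun setT cons_rV.
Proof.
apply: measurable_fun_rVP => i; case: (unliftP ord0 i) => [j|] ->.
  under eq_fun do rewrite cons_rVS.
  by apply: (measurableT_comp (measurable_rV_coor j)); exact: measurable_snd.
under eq_fun do rewrite cons_rV0.
exact: measurable_fst.
Qed.

Lemma measurable_behead_rV : measurable_fun setT behead_rV.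
Proof.
apply: measurable_fun_pair; first exact: measurable_rV_coor.
apply: measurable_fun_rVP => i.
rewrite (_ : (fun _ => _) = fun x : 'rV[R]_n.+1 => x ord0 (lift ord0 i)).
  exact: measurable_rV_coor.
apply/funext => x; rewrite mxE; congr (x _ _).
by apply/val_inj.
Qed.

Lemma cons_rVK : cancel cons_rV behead_rV.
Proof.
move=> [x v]; congr pair; first exact: cons_rV0.
by rewrite /cons_rV row_mxKr.
Qed.

Definition lebesgue_rV_succ := pushforward (lebesgue_measure \x mu)%E cons_rV.

Let lebesgue_rV_succ0 : lebesgue_rV_succ set0 = 0%E.
Proof. by rewrite /lebesgue_rV_succ /pushforward preimage_set0 measure0. Qed.

Let lebesgue_rV_succ_ge0 A : (0 <= lebesgue_rV_succ A)%E.
Proof. exact: (measure_ge0 (lebesgue_measure \x mu)%E). Qed.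

Let lebesgue_rV_succ_sigma_additive : semi_sigma_additive lebesgue_rV_succ.
Proof.
rewrite /lebesgue_rV_succ; have mc := measurable_cons_rV.
exact: measure_semi_sigma_additive.
Qed.

HB.instance Definition _ := isMeasure.Build _ _ _ lebesgue_rV_succ
  lebesgue_rV_succ0 lebesgue_rV_succ_ge0 lebesgue_rV_succ_sigma_additive.

Let lebesgue_rV_succ_sigma_finite : sigma_finite setT lebesgue_rV_succ.
Proof.
have /sigma_finiteP[F [TF ndF Foo]] := sigma_finiteT (@lebesgue_measure R).
have /sigma_finiteP[G [TG ndG Goo]] := sigma_finiteT mu.
exists (fun k => behead_rV @^-1` (F k `*` G k)).
  rewrite -preimage_bigcup (_ : \bigcup_i _ = setT) ?preimage_setT//.
  apply/seteqP; split => // -[x y] _.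
  have [i _ Fx] : (\bigcup_i F i) x by rewrite -TF.
  have [j _ Gy] : (\bigcup_i G i) y by rewrite -TG.
  exists (maxn i j) => //; split => /=.
    by move: x Fx; exact/subsetPset/ndF/leq_maxl.
  by move: y Gy; exact/subsetPset/ndG/leq_maxr.
move=> k; have [mF Fk] := Foo k; have [mG Gk] := Goo k; split.
  by rewrite -[X in measurable X]setTI; apply: measurable_behead_rV => //;
    exact: measurableX.
rewrite /lebesgue_rV_succ /pushforward -comp_preimage.
rewrite (_ : _ \o _ = id) ?preimage_id; last exact/funext/cons_rVK.
by rewrite product_measure1E// lte_mul_pinfty// ge0_fin_numE.
Qed.

HB.instance Definition _ := Measure_isSigmaFinite.Build _ _ _ lebesgue_rV_succ
  lebesgue_rV_succ_sigma_finite.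

End lebesgue_rV_succ.

(* Lebesgue measure on R^n, as an iterated product of the one on R. *)
Fixpoint lebesgue_rV {R : realType} (n : nat) :
    {sigma_finite_measure set 'rV[R]_n -> \bar R} :=
  match n with
  | 0 => \d_(0 : 'rV[R]_0)
  | m.+1 => lebesgue_rV_succ (lebesgue_rV m)
  end.

Section function_spaces.
Context {R : realType} {d : nat}.
Variable Omega : set 'rV[R]_d.

Local Notation mu := (lebesgue_rV d).
Local Notation e_ i := (delta_mx ord0 i : 'rV[R]_d).

Implicit Types (f p phi : 'rV[R]_d -> R) (g u v w : 'rV[R]_d -> 'rV[R]_d).

Definition iter_partial (s : seq 'I_d) f : 'rV[R]_d -> R :=
  foldr (fun i h => 'D_(e_ i) h) f s.

Definition smooth f := forall s : seq 'I_d,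
  continuous (iter_partial s f) /\
  forall i x, derivable (iter_partial s f) x (e_ i).

Definition test_function phi := smooth phi /\
  exists K, [/\ compact K, K `<=` Omega & forall x, ~ K x -> phi x = 0].

(* Membership in L^2(Omega): the extension by zero is square integrable on R^d. *)
Definition L2 f : Prop := f \_ Omega \in Lfun mu 2%:E.

Definition vL2 u := forall i, L2 (fun x => u x ord0 i).

Definition is_weak_grad f g := vL2 g /\
  forall phi, test_function phi -> forall i,
    \int[mu]_(x in Omega) (f x * 'D_(e_ i) phi x) =
    - \int[mu]_(x in Omega) (g x ord0 i * phi x).

(* A representative of the weak gradient, which is unique up to a null set. *)
Definition wgrad f : 'rV[R]_d -> 'rV[R]_d := xget 0 [set g | is_weak_grad f g].

Definition H1 f := L2 f /\ exists g, is_weak_grad f g.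

Definition H10 f := H1 f /\
  exists phi_ : nat -> 'rV[R]_d -> R, [/\ forall m, test_function (phi_ m),
    \int[mu]_(x in Omega) (phi_ m x - f x) ^+ 2 @[m --> \oo] --> 0 &
    forall i, \int[mu]_(x in Omega) ('D_(e_ i) (phi_ m) x - wgrad f x ord0 i) ^+ 2
      @[m --> \oo] --> 0].

Definition vH10 u := forall i, H10 (fun x => u x ord0 i).

Definition inner m n (U V : 'rV[R]_d -> 'M[R]_(m, n)) : R :=
  \int[mu]_(x in Omega) (\sum_i \sum_j U x i j * V x i j).

Definition normL2 m n (U : 'rV[R]_d -> 'M[R]_(m, n)) : R :=
  Num.sqrt (inner U U).

(* The entry (i, j) is the j-th partial derivative of the i-th component. *)
Definition vgrad u (x : 'rV[R]_d) : 'M[R]_d :=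
  \matrix_i wgrad (fun y => u y ord0 i) x.

Definition divergence u (x : 'rV[R]_d) : R := \tr (vgrad u x).

Definition div_free u := {ae mu, forall x, Omega x -> divergence u x = 0}.

Definition convection w v (x : 'rV[R]_d) : 'rV[R]_d :=
  \row_i \sum_j w x ord0 j * vgrad v x i j.

Definition normH1 u : R := Num.sqrt (normL2 u ^+ 2 + normL2 (vgrad u) ^+ 2).

Definition simple_field (S : R -> 'rV[R]_d -> 'rV[R]_d) :=
  exists N (A : 'I_N -> set R) (G : 'I_N -> 'rV[R]_d -> 'rV[R]_d),
    [/\ forall j, measurable (A j), forall j, vL2 (G j) &
        forall t x, S t x = \sum_j \1_(A j) t *: G j x].

Definition strongly_measurable (F : R -> 'rV[R]_d -> 'rV[R]_d) :=
  exists S : nat -> R -> 'rV[R]_d -> 'rV[R]_d,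
    (forall m, simple_field (S m)) /\
    {ae lebesgue_measure, forall t, 0 < t ->
      normL2 (S m t - F t) @[m --> \oo] --> 0}.

Definition Lnorm_LinfL2 (F : R -> 'rV[R]_d -> 'rV[R]_d) : \bar R :=
  Lnorm lebesgue_measure +oo%E
    (EFin \o ((fun t => normL2 (F t)) \_ `]0, +oo[%classic)).

Definition LinfL2 F := [/\ forall t : R, 0 < t -> vL2 (F t),
  strongly_measurable F & (Lnorm_LinfL2 F < +oo)%E].

Definition norm_LinfL2 F : R := fine (Lnorm_LinfL2 F).

End function_spaces.

Section sav_scheme.
Context {R : realType} {d : nat}.
Variables (Omega : set 'rV[R]_d) (Re gamma k : R).

Local Notation mu := (lebesgue_rV d).
Local Notation inner := (inner Omega).
Local Notation vgrad := (vgrad Omega).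
Local Notation divergence := (divergence Omega).
Local Notation convection := (convection Omega).

Implicit Types (p : 'rV[R]_d -> R) (a w u v f : 'rV[R]_d -> 'rV[R]_d).

(* Weak form of  a - Re^-1 Delta u + q (w . grad) w + grad p = f.  For w and v
   in H^1_0 the trilinear term is a convergent integral, by the Sobolev
   embedding in dimensions 2 and 3. *)
Definition weak_momentum a w (q : R) u p f := forall v, vH10 Omega v ->
  inner a v + Re^-1 * inner (vgrad u) (vgrad v)
  + q * inner (convection w w) v
  - \int[mu]_(x in Omega) (p x * divergence v x) = inner f v.

Definition sav_step a w f u p (dq q : R) :=
  [/\ vH10 Omega u, div_free Omega u, L2 Omega p,
      weak_momentum a w q u p f &
      dq + gamma * q - inner (convection w w) u = gamma].

Definition sav_bdf1_step u0 (q0 : R) f u1 p1 (q1 : R) :=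
  sav_step (k^-1 *: (u1 - u0)) u0 f u1 p1 ((q1 - q0) / k) q1.

Definition sav_bdf2_step u0 u1 (q0 q1 : R) f u2 p2 (q2 : R) :=
  sav_step ((2 * k)^-1 *: (3 *: u2 - 4 *: u1 + u0)) (2 *: u1 - u0) f u2 p2
    ((3 * q2 - 4 * q1 + q0) / (2 * k)) q2.

Definition sav_scheme u0 (F : R -> 'rV[R]_d -> 'rV[R]_d)
    (u : nat -> 'rV[R]_d -> 'rV[R]_d) (p : nat -> 'rV[R]_d -> R)
    (q : nat -> R) :=
  [/\ u 0 = u0, q 0 = 1,
      sav_bdf1_step (u 0) (q 0) (F k) (u 1) (p 1) (q 1) &
      forall n, (1 <= n)%N -> sav_bdf2_step (u n.-1) (u n) (q n.-1) (q n)
        (F (n.+1%:R * k)) (u n.+1) (p n.+1) (q n.+1)].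

End sav_scheme.

(* Main.v *)
(* Testing the momentum equation with u^{n+1} and multiplying the q-equation by
   q^{n+1}, the convection terms cancel and the pressure term vanishes, which
   leaves a linear energy balance with dissipation |grad u|^2 / Re + gamma q^2.
   With the Poincare inequality and Young's inequality this gives, for
   X_n = |u^n|^2 + (q^n)^2 and the G-norm energy
   E_n = X_{n+1} + |2 u^{n+1} - u^n|^2 + (2 q^{n+1} - q^n)^2,
     E_{n+1} + 4 k alpha X_{n+2} <= E_n + 4 k beta.
   Then E_n + 2 k alpha X_{n+1} <= (1 + 2 k alpha) B for a B independent of k, and
   this energy dominates (1 + 2 k alpha) X_{n+1}.  The Poincare inequality is
   proved by slicing test functions along the first coordinate: for h vanishing
   at -M and M, the integral of (t h^2)' is zero. *)

Require Import Defs.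
From mathcomp Require Import all_boot all_order all_algebra.
From mathcomp Require Import all_classical all_reals all_analysis.
From mathcomp Require Import measurable_realfun.
From mathcomp Require Import ring lra.

Import Order.TTheory GRing.Theory Num.Theory.
Import numFieldNormedType.Exports.

Local Open Scope classical_set_scope.
Local Open Scope ring_scope.

Set Implicit Arguments.
Unset Strict Implicit.
Unset Printing Implicit Defensive.

(** * Measurability of open sets and finite measure of cubes *)

Lemma measurable_box {R : realType} {n : nat} (c : 'rV[R]_n) (r : R) :
  measurable [set x : 'rV[R]_n | forall i, `|x ord0 i - c ord0 i| < r].
Proof.
rewrite (_ : [set _ | _] = \bigcap_(i in setT)
    ((fun x : 'rV[R]_n => x ord0 i) @^-1` `]c ord0 i - r, c ord0 i + r[%classic)).
  apply: fin_bigcap_measurable => // i _.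
  by rewrite -[X in measurable X]setTI; apply: measurable_rV_coor.
apply/seteqP; split=> [x xr i _|x xr i] /=.
  by rewrite in_itv/= -ltr_distl; exact: xr.
by have := xr i I; rewrite /= in_itv/= -ltr_distl.
Qed.

(** The sigma-algebra is generated by the coordinates, so an open set is recovered as a countable
    union: the boxes with rational centre and radius that it contains. *)
Lemma open_measurable_rV {R : realType} {n : nat} (U : set 'rV[R]_n) :
  open U -> measurable U.
Proof.
move=> oU.
pose box (cr : 'rV[rat]_n * rat) : set 'rV[R]_n :=
  [set x | forall i, `|x ord0 i - map_mx ratr cr.1 ord0 i| < ratr cr.2].
rewrite (_ : U = \bigcup_cr (if `[< box cr `<=` U >] then box cr else set0)).
  apply: countable_bigcupT_measurable => // cr.
  by case: ifP => // _; exact: measurable_box.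
apply/seteqP; split=> [x Ux|x [cr _]]; last first.
  by case: ifP => // /asboolP; exact.
have /nbhs_ballP[e /= e0 xeU] : nbhs x U by exact: open_nbhs_nbhs.
(* With a radius below [e / 2], [x] and any point of the box are both within [r] of the centre,
   hence within [e] of each other. *)
have [r] := rat_in_itvoo (divr_gt0 e0 (ltr0Sn R 1)).
rewrite in_itv/= => /andP[r0 re].
have [c xc] : exists c : 'I_n -> rat, forall i, `|x ord0 i - ratr (c i)| < ratr r.
  suff xc i : exists q : rat, `|x ord0 i - ratr q| < ratr r.
    by exists (fun i => projT1 (cid (xc i))) => i; exact: projT2 (cid (xc i)).
  have [|q] := @rat_in_itvoo R (x ord0 i - ratr r) (x ord0 i + ratr r).
    by rewrite ltrD2l gt0_cp.
  by rewrite in_itv/= -ltr_distl distrC; exists q.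
exists (\row_i c i, r) => //.
have cx : box (\row_i c i, r) x by move=> i /=; rewrite !mxE; exact: xc.
case: ifPn => // /negP; case; apply/asboolP => y yc; apply: xeU; split=> // i j.
rewrite ord1 /ball/=.
have := yc j; have := xc j; rewrite /= !mxE => h1 h2.
rewrite (_ : _ - _ = (x ord0 j - ratr (c j)) - (y ord0 j - ratr (c j))); last by ring.
by rewrite (le_lt_trans (ler_normB _ _))// (splitr e) ltrD// ?(lt_trans h1 re)// (lt_trans h2 re).
Qed.

Lemma continuous_measurable_rV {R : realType} {n : nat} (f : 'rV[R]_n -> R) :
  continuous f -> measurable_fun setT f.
Proof.
move=> cf; apply: (measurability _ (RGenOpens.measurableE R)).
move=> _ [_ [a [b ->] <-]]; rewrite setTI.
by apply: open_measurable_rV; move/continuousP: cf; apply; exact: interval_open.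
Qed.

Lemma cons_rV_ord0 {R : realType} {n : nat} (z : measurableTypeR R * 'rV[R]_n) :
  cons_rV z ord0 ord0 = z.1.
Proof.
rewrite /cons_rV mxE; case: splitP => [j|[]//].
by rewrite ord1 mxE eqxx mulr1n.
Qed.

Lemma cons_rV_lift {R : realType} {n : nat} (z : measurableTypeR R * 'rV[R]_n) i :
  cons_rV z ord0 (lift ord0 i) = z.2 ord0 i.
Proof.
have -> : lift ord0 i = rshift 1 i :> 'I_n.+1 by apply/val_inj.
exact: row_mxEr.
Qed.

Lemma measurable_cube {R : realType} {n : nat} (r : R) :
  measurable [set x : 'rV[R]_n | forall i, `|x ord0 i| < r].
Proof.
have := measurable_box (0 : 'rV[R]_n) r; congr (measurable _).
by apply/seteqP; split=> x xr i; have := xr i; rewrite /= mxE subr0.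
Qed.

Lemma lebesgue_rV_cube_fin {R : realType} (n : nat) (r : R) :
  (lebesgue_rV n [set x : 'rV[R]_n | forall i, `|x ord0 i| < r]%R < +oo)%E.
Proof.
elim: n => [|n IH] /=; first by rewrite diracE; case: (_ \in _); rewrite ltry.
rewrite /lebesgue_rV_succ /pushforward.
set B := _ @^-1` _.
rewrite (_ : B = `]-r, r[%classic `*`
    [set x : 'rV[R]_n | forall i, `|x ord0 i| < r]%R); last first.
  apply/seteqP; split=> [[t v] H|[t v] [/= tr vr]]; last first.
    rewrite /B/= => i; case: (unliftP ord0 i) => [j|] ->.
      by rewrite cons_rV_lift.
    by rewrite cons_rV_ord0/= ltr_norml; rewrite in_itv/= in tr.
  rewrite {}/B/= in H; split=> [|i]/=.
    by rewrite in_itv/= -ltr_norml; move: (H ord0); rewrite cons_rV_ord0.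
  by move: (H (lift ord0 i)); rewrite cons_rV_lift.
rewrite product_measure1E//; last exact: measurable_cube.
rewrite lte_mul_pinfty// ge0_fin_numE//.
have := lebesgue_measure_itv `]-r, r[; rewrite /= => ->.
by case: ifP => _; rewrite ltry.
Qed.

(** * Square integrable functions and bilinearity of the inner product *)

Section L2_space.
Context {R : realType} {d : nat}.
Variable Omega : set 'rV[R]_d.
Hypothesis mOmega : measurable Omega.

Local Notation mu := (lebesgue_rV d).
Local Notation L2 := (L2 Omega).
Local Notation vL2 := (vL2 Omega).
Local Notation inner := (inner Omega).

Lemma L2D (f g : 'rV[R]_d -> R) : L2 f -> L2 g -> L2 (fun x => f x + g x).
Proof.
move=> f2 g2; rewrite /Defs.L2.
have -> : (fun x => f x + g x) \_ Omega = f \_ Omega + g \_ Omega.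
  by apply/funext => x; rewrite !fctE !patchE; case: ifP => _; rewrite ?addr0.
have p1 : (1 <= 2%:E :> \bar R)%E by rewrite lee_fin ler1n.
by have [_ H] := Lfun_addr_closed mu p1; exact: H f2 g2.
Qed.

Lemma L2Z (a : R) (f : 'rV[R]_d -> R) : L2 f -> L2 (fun x => a * f x).
Proof.
move=> f2; rewrite /Defs.L2.
have -> : (fun x => a * f x) \_ Omega = a \o* f \_ Omega.
  by apply/funext => x; rewrite /= !patchE; case: ifP => _; rewrite ?mul0r// mulrC.
by apply: Lfun_scale; rewrite ?ler1n.
Qed.

Lemma L2_measurable (f : 'rV[R]_d -> R) : L2 f -> measurable_fun Omega f.
Proof.
move=> /sub_Lfun_mfun; rewrite inE => mf.
by apply/(measurable_restrictT _ mOmega).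
Qed.

(** Hölder with both exponents 2. The linearity rules for [Rintegral] ask for integrability, so
    those for [inner] rest on this. *)
Lemma L2_mul_integrable (f g : 'rV[R]_d -> R) : L2 f -> L2 g ->
  mu.-integrable Omega (EFin \o (fun x => f x * g x)).
Proof.
move=> f2 g2; apply/(integrable_mkcond _ mOmega).
have /Lfun1_integrable := Lfun2_mul_Lfun1 f2 g2.
congr (_.-integrable _ _); apply/funext => x /=.
by rewrite !patchE; case: ifP => _; rewrite ?mulr0.
Qed.

Lemma L2_sum_mul_integrable (m n : nat) (U V : 'rV[R]_d -> 'M[R]_(m, n)) :
  (forall i j, L2 (fun x => U x i j)) -> (forall i j, L2 (fun x => V x i j)) ->
  mu.-integrable Omega (EFin \o (fun x => \sum_i \sum_j U x i j * V x i j)).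
Proof.
move=> U2 V2.
rewrite (_ : _ \o _ = fun x => (\sum_i \sum_j (U x i j * V x i j)%:E)%E).
  by do 2![apply: integrable_sum => // ? _]; exact: L2_mul_integrable.
by apply/funext => x /=; rewrite -sumEFin; apply: eq_bigr => i _; rewrite sumEFin.
Qed.

Lemma innerC m n (U V : 'rV[R]_d -> 'M[R]_(m, n)) : inner U V = inner V U.
Proof.
apply: eq_Rintegral => x _; apply: eq_bigr => i _; apply: eq_bigr => j _.
exact: mulrC.
Qed.

Lemma inner_ge0 m n (U : 'rV[R]_d -> 'M[R]_(m, n)) : 0 <= inner U U.
Proof.
by apply: Rintegral_ge0 => x _; do 2!apply: sumr_ge0 => ? _; rewrite -expr2 sqr_ge0.
Qed.

Lemma vL2D (u v : 'rV[R]_d -> 'rV[R]_d) : vL2 u -> vL2 v -> vL2 (u + v).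
Proof.
move=> u2 v2 i; have := L2D (u2 i) (v2 i); congr (L2 _).
by apply/funext => x; rewrite !mxE.
Qed.

Lemma vL2Z (a : R) (u : 'rV[R]_d -> 'rV[R]_d) : vL2 u -> vL2 (a *: u).
Proof.
move=> u2 i; have := L2Z a (u2 i); congr (L2 _).
by apply/funext => x; rewrite !mxE.
Qed.

Lemma innerDl (u v w : 'rV[R]_d -> 'rV[R]_d) : vL2 u -> vL2 v -> vL2 w ->
  inner (u + v) w = inner u w + inner v w.
Proof.
move=> u2 v2 w2; rewrite /Defs.inner -RintegralD//.
- apply: eq_Rintegral => x _; rewrite -big_split/=; apply: eq_bigr => i _.
  by rewrite -big_split/=; apply: eq_bigr => j _; rewrite !mxE mulrDl.
- by apply: L2_sum_mul_integrable => i j; rewrite (ord1 i).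
- by apply: L2_sum_mul_integrable => i j; rewrite (ord1 i).
Qed.

Lemma innerZl (a : R) (u w : 'rV[R]_d -> 'rV[R]_d) : vL2 u -> vL2 w ->
  inner (a *: u) w = a * inner u w.
Proof.
move=> u2 w2; rewrite /Defs.inner -RintegralZl//.
- apply: eq_Rintegral => x _; rewrite mulr_sumr; apply: eq_bigr => i _.
  by rewrite mulr_sumr; apply: eq_bigr => j _; rewrite !mxE mulrA.
- by apply: L2_sum_mul_integrable => i j; rewrite (ord1 i).
Qed.

(** [wgrad] has the default value 0; the existence clause of [H1] makes [xget] return a genuine weak
    gradient. *)
Lemma L2_wgrad (f : 'rV[R]_d -> R) : H1 Omega f -> vL2 (wgrad Omega f).
Proof.
move=> [_ [g fg]]; have [] // : is_weak_grad Omega f (wgrad Omega f).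
exact: (xgetI 0 fg).
Qed.

End L2_space.

(** * Poincaré inequality on a segment and, by slicing, for test functions *)

Lemma poincare_segment {R : realType} (M : R) (h h' : R -> R) : 0 < M ->
  (forall t : R, is_derive t 1 h (h' t)) -> continuous h' -> h M = 0 -> h (- M) = 0 ->
  (\int[lebesgue_measure]_(t in `[(- M)%R, M]) (h t ^+ 2)%:E <=
   (4 * M ^+ 2)%:E * \int[lebesgue_measure]_(t in `[(- M)%R, M]) (h' t ^+ 2)%:E)%E.
Proof.
move=> M0 dh ch' hM hNM.
have ch : continuous h.
  by move=> t; apply: differentiable_continuous; apply/derivable1_diffP; case: (dh t).
have MM : - M < M by rewrite gt0_cp.
(* On [-M, M], g' >= h^2 / 2 - 2 M^2 h'^2, while g' integrates to 0. *)
pose g t := t * h t ^+ 2; pose g' t := h t ^+ 2 + 2 * t * h t * h' t.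
have dg (t : R) : is_derive t 1 g (g' t).
  apply: is_derive_eq; rewrite /g' /GRing.scale/=; ring.
have cM (f1 f2 : R -> R) : continuous f1 -> continuous f2 ->
    continuous (fun t => f1 t * f2 t).
  by move=> c1 c2 t; apply: cvgM; [exact: c1|exact: c2].
have ch2 : continuous (fun t => h t ^+ 2) by exact: cM.
have ch'2 : continuous (fun t => h' t ^+ 2) by exact: cM.
have cc a (f : R -> R) : continuous f -> continuous (fun t => a * f t).
  by apply: (cM (cst a) f) => ?; exact: cvg_cst.
have cg' : continuous g'.
  move=> t; apply: cvgD; first exact: ch2.
  apply: (cM (fun t => 2 * t * h t) h') => //.
  by apply: (cM (fun t => 2 * t) h) => //; apply: (cc 2 id) => ?; exact: cvg_id.
have cg : continuous g.
  by move=> t; apply: differentiable_continuous; apply/derivable1_diffP; case: (dg t).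
have int (f : R -> R) : continuous f ->
    lebesgue_measure.-integrable `[- M, M] (EFin \o f).
  move=> cf; apply: continuous_compact_integrable; first exact: segment_compact.
  exact: continuous_subspaceT.
have int0 : (\int[lebesgue_measure]_(t in `[(- M)%R, M]) (g' t)%:E = 0)%E.
  rewrite (@continuous_FTC2 _ g' g)//.
  - by rewrite /g hM hNM expr0n/= !mulr0 subee.
  - exact: continuous_subspaceT.
  - split.
    + by move=> t _; case: (dg t).
    + exact/cvg_at_right_filter/cg.
    + exact/cvg_at_left_filter/cg.
  - by move=> t _; rewrite derive1E derive_val.
have fin (f : R -> R) : continuous f ->
    (\int[lebesgue_measure]_(t in `[(- M)%R, M]) (f t)%:E)%E \is a fin_num.
  by move=> cf; apply: (integrable_fin_num _ (int _ cf)).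
pose r := fun t => g' t + (- 2^-1 * (h t ^+ 2) + 2 * M ^+ 2 * (h' t ^+ 2)).
have r0 : 0 <= \int[lebesgue_measure]_(t in `[- M, M]) r t.
  apply: Rintegral_ge0 => t /=; rewrite in_itv/= => /andP[Mt tM].
  (* Completing the square in [h t] leaves a remainder with the sign of [M ^+ 2 - t ^+ 2]. *)
  have -> : r t = 2^-1 * (h t + 2 * t * h' t) ^+ 2 + 2 * (M ^+ 2 - t ^+ 2) * h' t ^+ 2.
    by rewrite /r /g'; field.
  have tM2 : 0 <= M ^+ 2 - t ^+ 2 by nra.
  by rewrite addr_ge0// mulr_ge0 ?sqr_ge0 ?invr_ge0// mulr_ge0.
have mI : measurable `[- M, M] by exact: measurable_itv.
clearbody g'; move: r0; rewrite RintegralD//; [|exact: int|]; last first.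
  by apply: int => t; apply: cvgD; [exact: (cc _ _ ch2 t)|exact: (cc _ _ ch'2 t)].
rewrite RintegralD//; [|exact: int _ (cc _ _ ch2)|exact: int _ (cc _ _ ch'2)].
rewrite !RintegralZl//; [|exact: int|exact: int].
rewrite {1}/Rintegral int0 add0r => r0.
have /fineK <- := fin _ ch2; have /fineK <- := fin _ ch'2.
rewrite -EFinM lee_fin -!/(Rintegral _ _ _).
move: r0; set A := Rintegral _ _ _; set B := Rintegral _ _ _ => r0.
by nra.
Qed.

Lemma cons_rVD {R : realType} {n : nat} (s t : R) (v : 'rV[R]_n) :
  cons_rV (s + t, v) = s *: delta_mx ord0 ord0 + cons_rV (t, v).
Proof.
apply/rowP => i; rewrite [RHS]mxE.
have -> : (s *: (delta_mx ord0 ord0 : 'rV[R]_n.+1)) ord0 i = s * (i == ord0)%:R.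
  by rewrite !mxE.
case: (unliftP ord0 i) => [j|] ->; last by rewrite !cons_rV_ord0 mulr1.
by rewrite !cons_rV_lift mulr0 add0r.
Qed.

Lemma continuous_cons_rV {R : realType} {n : nat} (v : 'rV[R]_n) :
  continuous (fun t : R => cons_rV (t, v)).
Proof.
move=> t.
have -> : (fun t : R => cons_rV (t, v)) =
    fun t : R => t *: (delta_mx ord0 ord0 : 'rV[R]_n.+1) + cons_rV (0, v).
  by apply/funext => s; rewrite -cons_rVD addr0.
by apply: cvgD; [exact: scalel_continuous|exact: cvg_cst].
Qed.

(** Moving the first coordinate is a translation along [delta_mx ord0 ord0], so the slice and the
    directional derivative have the same difference quotients. *)
Lemma is_derive_cons_rV {R : realType} {n : nat} (f : 'rV[R]_n.+1 -> R) v (t : R) :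
  derivable f (cons_rV (t, v)) (delta_mx ord0 ord0) ->
  is_derive t 1 (fun s : R => f (cons_rV (s, v)))
    ('D_(delta_mx ord0 ord0) f (cons_rV (t, v))).
Proof.
have E : (fun s : R => s^-1 *: (f (cons_rV (s *: 1 + t, v)) - f (cons_rV (t, v)))) =
  (fun s : R => s^-1 *: (f (s *: delta_mx ord0 ord0 + cons_rV (t, v)) - f (cons_rV (t, v)))).
  by apply/funext => s; rewrite -cons_rVD /GRing.scale/= mulr1.
by move=> df; split; rewrite /derivable/derive/= ?E.
Qed.

Lemma derive_outside {R : realType} {V : normedModType R} (f : V -> R) (K : set V) (e : V) :
  closed K -> (forall x, ~ K x -> f x = 0) -> forall x, ~ K x -> 'D_e f x = 0.
Proof.
move=> clK f0 x Kx.
rewrite (@near_eq_derive _ _ _ f (cst 0)) ?derive_cst//.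
have : nbhs x (~` K) by apply: open_nbhs_nbhs; split => //; exact: closed_openC.
by apply: filterS => y; exact: f0.
Qed.

(** [lebesgue_rV n.+1] is the image of a product measure under [cons_rV], so a change of variables
    reduces the claim to Tonelli. *)
Lemma tonelli_rV {R : realType} {n : nat} (f : 'rV[R]_n.+1 -> \bar R) :
  measurable_fun setT f -> (forall x, 0 <= f x)%E ->
  (\int[lebesgue_rV n.+1]_x f x =
   \int[lebesgue_rV n]_v \int[lebesgue_measure]_t f (cons_rV (t, v)))%E.
Proof.
move=> mf f0.
have -> : (\int[lebesgue_rV n.+1]_x f x =
    \int[(lebesgue_measure \x lebesgue_rV n)%E]_z f (cons_rV z))%E.
  by rewrite (ge0_integral_pushforward (measurable_cons_rV (R:=R) (n:=n)))// ?preimage_setT.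
rewrite (fubini_tonelli2 (fun z => f (cons_rV z)))//.
by apply: measurableT_comp => //; exact: measurable_cons_rV.
Qed.

Lemma poincare_test {R : realType} {n : nat} (Omega : set 'rV[R]_n.+1) (M : R)
    (phi : 'rV[R]_n.+1 -> R) :
  0 < M -> (forall x, Omega x -> `|x ord0 ord0| < M) -> test_function Omega phi ->
  (\int[lebesgue_rV n.+1]_x (phi x ^+ 2)%:E <= (4 * M ^+ 2)%:E *
   \int[lebesgue_rV n.+1]_x ('D_(delta_mx ord0 ord0) phi x ^+ 2)%:E)%E.
Proof.
move=> M0 OM [sphi [K [cK KO phi0]]].
have [cphi dphi] := sphi [::].
have [cdphi _] := sphi [:: ord0].
rewrite /= in cphi dphi cdphi.
set phi' := 'D_(delta_mx ord0 ord0) phi in cdphi *.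
have mphi : measurable_fun setT phi by exact: continuous_measurable_rV.
have mphi' : measurable_fun setT phi' by exact: continuous_measurable_rV.
have msq (f : 'rV[R]_n.+1 -> R) : continuous f ->
    measurable_fun setT (fun x : 'rV[R]_n.+1 => (f x ^+ 2)%:E).
  move=> cf; apply/measurable_EFinP; apply: measurable_funX.
  exact: continuous_measurable_rV.
have mslice (f : 'rV[R]_n.+1 -> R) : continuous f -> measurable_fun setT
    (fun v => \int[lebesgue_measure]_t (f (cons_rV (t, v)) ^+ 2)%:E)%E.
  move=> cf; apply: (measurable_fun_fubini_tonelli_G
    (fun z => (f (cons_rV z) ^+ 2)%:E)); last first.
    by move=> ?; rewrite lee_fin sqr_ge0.
  apply: (measurableT_comp (msq _ cf)); exact: measurable_cons_rV.
have sq0 (r : R) : (0 <= (r ^+ 2)%:E)%E by rewrite lee_fin sqr_ge0.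
rewrite !tonelli_rV//; [|exact: msq..].
rewrite -ge0_integralZl//; last first.
- by rewrite lee_fin mulr_ge0// sqr_ge0.
- by move=> v _; apply: integral_ge0.
- exact: (mslice phi').
apply: ge0_le_integral => //.
- by move=> v _; apply: integral_ge0.
- exact: (mslice phi).
- by apply: measurable_funeM; exact: (mslice phi').
move=> v _.
(* The bound in [OM] is strict, so the slice vanishes at the endpoints [M] and [- M] too. *)
have vanish t : M <= `|t| -> phi (cons_rV (t, v)) = 0.
  move=> Mt; apply: phi0 => /KO/OM; rewrite cons_rV_ord0/=.
  by rewrite ltNge Mt.
have := @poincare_segment R M (fun t => phi (cons_rV (t, v)))
  (fun t => phi' (cons_rV (t, v))) M0.
move=> /(_ (fun t => is_derive_cons_rV (dphi ord0 (cons_rV (t, v))))).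
have cslice : continuous (fun t : R => phi' (cons_rV (t, v))).
  move=> t; apply: (@continuous_comp _ _ _ (fun t : R => cons_rV (t, v)) phi').
    exact: continuous_cons_rV.
  exact: cdphi.
move=> /(_ cslice (vanish _ _) (vanish _ _)).
rewrite normrN gtr0_norm// => /(_ (lexx _) (lexx _)) H.
(* Passing from the segment to the whole line changes nothing on the left, where the slice vanishes
   outside, and can only enlarge the nonnegative integral on the right. *)
apply: (le_trans _ (le_trans H _)).
  rewrite [leRHS]integral_mkcond le_eqVlt; apply/orP; left; apply/eqP.
  apply: eq_integral => t _; rewrite patchE; case: ifPn => //.
  rewrite notin_setE/= in_itv/= -ler_norml => /negP; rewrite -ltNge => /ltW Mt.
  by rewrite vanish// expr0n.
rewrite lee_pmul2l// ?lte_fin ?mulr_gt0 ?exprn_gt0//.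
apply: ge0_subset_integral => //.
apply/measurable_EFinP; apply: measurable_funX.
apply: (measurableT_comp mphi').
apply: (measurableT_comp (measurable_cons_rV (n:=n))).
exact: pair2_measurable.
Qed.

(** * From test functions to H^1_0 *)

Lemma bounded_rV_box {R : realType} {n : nat} (A : set 'rV[R]_n) : bounded_set A ->
  exists2 r : R, 0 < r & forall x, A x -> forall i, `|x ord0 i| < r.
Proof.
move=> /ex_strict_bound_gt0[r r0 Ar]; exists r => // x Ax i.
apply: le_lt_trans (Ar _ Ax); rewrite [leRHS]/Num.Def.normr/= mx_normrE.
by apply/bigmax_geP; right => /=; exists (ord0, i).
Qed.

(** [g] is bounded on a compact cube containing [Omega], and [Omega] has finite measure. *)
Lemma L2_continuous {R : realType} {n : nat} (Omega : set 'rV[R]_n) (g : 'rV[R]_n -> R) :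
  measurable Omega -> bounded_set Omega -> continuous g -> L2 Omega g.
Proof.
move=> mO /bounded_rV_box[r r0 Or] cg.
have Obox : Omega `<=` [set x | forall i, `|x ord0 i| < r].
  by move=> x Ox i; exact: Or.
have Ofin : (lebesgue_rV n Omega < +oo)%E.
  apply: le_lt_trans (lebesgue_rV_cube_fin n r).
  by apply: le_measure => //; rewrite inE//; exact: measurable_cube.
pose Q := [set v : 'rV[R]_n | forall i, v ord0 i \in `[- r, r]].
have cQ : compact Q.
  by apply: (@rV_compact _ _ (fun=> `[- r, r]%classic)) => _; exact: segment_compact.
have [B B0 gB] : exists2 B, 0 < B & forall x, Omega x -> `|g x| < B.
  have /compact_bounded/ex_strict_bound_gt0[B B0 gB] : compact (g @` Q).
    by apply: continuous_compact cQ; exact: continuous_subspaceT.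
  exists B => // x Ox; apply: gB; exists x => // i.
  by rewrite in_itv/= -ler_norml ltW// Or.
have mg : measurable_fun setT (g \_ Omega).
  apply/(measurable_restrictT _ mO); apply: measurable_funTS.
  exact: continuous_measurable_rV.
rewrite /L2 inE; apply/andP; split; first by rewrite inE.
rewrite inE/= /finite_norm unlock poweR_lty//.
apply: (@le_lt_trans _ _ (\int[lebesgue_rV n]_(x in Omega) (B ^+ 2)%:E)%E); last first.
  by rewrite integral_cst// lte_mul_pinfty// lee_fin sqr_ge0.
rewrite [leRHS]integral_mkcond; apply: ge0_le_integral => //=.
- apply/measurable_EFinP/(measurableT_comp (measurable_powR _)).
  exact: measurableT_comp.
- apply/(measurable_restrictT _ mO); exact: measurable_cst.
move=> x _; rewrite !patchE; case: ifPn => [|_]; last first.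
  by rewrite normr0 powR0.
rewrite inE => Ox; rewrite lee_fin powR_mulrn// ler_sqr ?nnegrE ?(ltW B0)//.
by rewrite ltW// gB.
Qed.

(** The integrands differ by [(2 * g x - f x) ^+ 2]. It serves to carry an inequality through an L^2
    limit; each use costs a factor 2. *)
Lemma L2_sqr_le_shift {R : realType} {n : nat} (Omega : set 'rV[R]_n) f g :
  measurable Omega -> L2 Omega f -> L2 Omega g ->
  \int[lebesgue_rV n]_(x in Omega) f x ^+ 2 <=
    2 * \int[lebesgue_rV n]_(x in Omega) (g x - f x) ^+ 2 +
    2 * \int[lebesgue_rV n]_(x in Omega) g x ^+ 2.
Proof.
move=> mO f2 g2.
have h2 : L2 Omega (fun x => g x - f x).
  have := L2D g2 (L2Z (-1) f2); congr (L2 _ _).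
  by apply/funext => x; rewrite mulN1r.
have ih := L2_mul_integrable mO h2 h2.
have ig := L2_mul_integrable mO g2 g2.
have iff := L2_mul_integrable mO f2 f2.
have ih2 := integrableZl mO 2 ih; have ig2 := integrableZl mO 2 ig.
rewrite -(RintegralZl 2 mO ih) -(RintegralZl 2 mO ig).
rewrite -RintegralD//; apply: le_Rintegral => //.
  exact: (integrableD mO ih2 ig2).
by move=> x _ /=; have := sqr_ge0 (2 * g x - f x); nra.
Qed.

Lemma Rintegral_sum {R : realType} {d} {T : measurableType d}
    (mu : {measure set T -> \bar R}) (D : set T) (I : Type) (s : seq I) (f : I -> T -> R) :
  measurable D -> (forall i, mu.-integrable D (EFin \o f i)) ->
  \int[mu]_(x in D) (\sum_(i <- s) f i x) = \sum_(i <- s) \int[mu]_(x in D) f i x.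
Proof.
move=> mD fi; elim: s => [|i s IH].
  under eq_Rintegral do rewrite big_nil.
  by rewrite big_nil Rintegral_cst// mul0r.
under eq_Rintegral do rewrite big_cons.
rewrite big_cons RintegralD ?IH//.
rewrite (_ : _ \o _ = fun x => (\sum_(i <- s) (f i x)%:E)%E); last first.
  by apply/funext => x /=; rewrite sumEFin.
by apply: integrable_sum => // j _; exact: fi.
Qed.

Section poincare.
Context {R : realType} {n : nat}.
Variables (Omega : set 'rV[R]_n.+1) (M : R).
Hypotheses (oO : open Omega) (bO : bounded_set Omega).
Hypotheses (M0 : 0 < M) (OM : forall x, Omega x -> `|x ord0 ord0| < M).

Local Notation mu := (lebesgue_rV n.+1).
Local Notation e0 := (delta_mx ord0 ord0 : 'rV[R]_n.+1).

Let mO : measurable Omega. Proof. exact: open_measurable_rV. Qed.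

Lemma L2_test phi : test_function Omega phi -> L2 Omega phi.
Proof. by move=> [/(_ [::])[cphi _] _]; exact: L2_continuous. Qed.

Lemma L2_partial_test phi i : test_function Omega phi ->
  L2 Omega ('D_(delta_mx ord0 i : 'rV[R]_n.+1) phi).
Proof. by move=> [/(_ [:: i])[cphi _] _]; exact: L2_continuous. Qed.

(** A test function and its derivative vanish off a compact part of [Omega], so integrals over the
    whole space and over [Omega] agree; being finite, they turn into real numbers. *)
Lemma poincare_test_Rintegral phi : test_function Omega phi ->
  \int[mu]_(x in Omega) phi x ^+ 2 <=
  4 * M ^+ 2 * \int[mu]_(x in Omega) 'D_e0 phi x ^+ 2.
Proof.
move=> tphi; have := poincare_test M0 OM tphi.
have [_ [K [cK KO phi0]]] := tphi.
have clK : closed K by apply: compact_closed => //; exact: norm_hausdorff.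
have nK x : ~ Omega x -> ~ K x by move=> nO /KO.
have extend (f : 'rV[R]_n.+1 -> R) : (forall x, ~ K x -> f x = 0) ->
    (\int[mu]_x (f x ^+ 2)%:E = \int[mu]_(x in Omega) (f x ^+ 2)%:E)%E.
  move=> f0; rewrite [RHS]integral_mkcond; apply: eq_integral => x _.
  rewrite patchE; case: ifPn => //; rewrite notin_setE => /nK/f0 ->.
  by rewrite expr0n.
rewrite (extend _ phi0) (extend _ (derive_outside e0 clK phi0)).
have fin f : L2 Omega f -> (\int[mu]_(x in Omega) (f x ^+ 2)%:E)%E \is a fin_num.
  by move=> f2; apply: integrable_fin_num => //; exact: (L2_mul_integrable mO f2 f2).
rewrite -(fineK (fin _ (L2_test tphi))) -(fineK (fin _ (L2_partial_test ord0 tphi))).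
by rewrite -EFinM lee_fin.
Qed.

Lemma poincare_H10 f : H10 Omega f ->
  \int[mu]_(x in Omega) f x ^+ 2 <=
  16 * M ^+ 2 * \int[mu]_(x in Omega) wgrad Omega f x ord0 ord0 ^+ 2.
Proof.
move=> [H1f [phi_ [tphi phif dphif]]].
have f2 := H1f.1.
have w2 := L2_wgrad H1f ord0.
set W := (X in _ <= _ * X).
(* For every [m] this quantity bounds the left side: shift [f] to [phi_ m], apply the inequality
   with constant [4 * M ^+ 2], then shift the derivative back to [wgrad]. The two factors 2 turn 4
   into 16. *)
have cv : 2 * \int[mu]_(x in Omega) (phi_ m x - f x) ^+ 2 +
   16 * M ^+ 2 * (\int[mu]_(x in Omega)
     ('D_e0 (phi_ m) x - wgrad Omega f x ord0 ord0) ^+ 2) + 16 * M ^+ 2 * W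
   @[m --> \oo] --> 2 * 0 + 16 * M ^+ 2 * 0 + 16 * M ^+ 2 * W.
  apply: cvgD; last exact: cvg_cst.
  by apply: cvgD; apply: cvgM => //; try exact: cvg_cst; exact: dphif.
move: cv; rewrite !mulr0 !add0r => cv.
refine (cvgr_to_ge cv _); apply: nearW => m.
have le1 := L2_sqr_le_shift mO f2 (L2_test (tphi m)).
have le2 := poincare_test_Rintegral (tphi m).
have := L2_sqr_le_shift mO (L2_partial_test ord0 (tphi m)) w2.
under [X in _ <= _ * X + _]eq_Rintegral do
  rewrite -[_ ^+ 2]sqrrN opprB.
rewrite -/W => le3; have M2 : 0 <= 4 * M ^+ 2 by rewrite mulr_ge0// sqr_ge0.
have := ler_wpM2l M2 le3; move: le1 le2; clear; lra.
Qed.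

(** Summing over components uses the first column of the gradient; the squares of the other columns
    are nonnegative. *)
Lemma poincare_vH10 u : vH10 Omega u ->
  inner Omega u u <= 16 * M ^+ 2 * inner Omega (vgrad Omega u) (vgrad Omega u).
Proof.
move=> u10.
have g2 i j : L2 Omega (fun x => vgrad Omega u x i j).
  have := L2_wgrad (u10 i).1 j; congr (L2 _ _).
  by apply/funext => x; rewrite mxE.
have u2 i : L2 Omega (fun x => u x ord0 i) by exact: (u10 i).1.1.
rewrite /inner; under eq_Rintegral do rewrite big_ord1.
rewrite Rintegral_sum//; last by move=> i; exact: L2_mul_integrable.
apply: (@le_trans _ _ (16 * M ^+ 2 * \sum_i \int[mu]_(x in Omega)
   (vgrad Omega u x i ord0 * vgrad Omega u x i ord0))).
  rewrite mulr_sumr; apply: ler_sum => i _.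
  have := poincare_H10 (u10 i); congr (_ <= _ * _).
  by apply: eq_Rintegral => x _; rewrite !mxE.
rewrite ler_pM2l ?mulr_gt0 ?exprn_gt0//.
rewrite -Rintegral_sum//; last by move=> i; exact: L2_mul_integrable.
apply: le_Rintegral => //.
- rewrite (_ : _ \o _ = fun x => (\sum_i
      (vgrad Omega u x i ord0 * vgrad Omega u x i ord0)%:E)%E).
    by apply: integrable_sum => // i _; exact: L2_mul_integrable.
  by apply/funext => x /=; rewrite sumEFin.
- exact: L2_sum_mul_integrable.
- move=> x _; apply: ler_sum => i _; rewrite big_ord_recl lerDl.
  by apply: sumr_ge0 => j _; rewrite -expr2 sqr_ge0.
Qed.

End poincare.

(** * Uniform bound for the two-step energy recursion *)

(** [X n] stands for the squared size of the state at level [n] and [Y n] for the product of levels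
    [n.+1] and [n]. The two sign conditions are the squares of twice the new state minus, or plus,
    the old one. *)
Lemma bdf2_recursion_bounded {R : realFieldType} (X Y : nat -> R) (a b B : R) :
  0 < a -> 9 * b <= a * B -> 9 * X 1 + 2 * X 0 <= B ->
  (forall n, 0 <= X n) ->
  (forall n, 0 <= 4 * X n.+1 - 4 * Y n + X n) ->
  (forall n, 0 <= 4 * X n.+1 + 4 * Y n + X n) ->
  (forall n, 5 * X n.+2 - 4 * Y n.+1 + X n.+1 + 2 * a * X n.+2 <=
     5 * X n.+1 - 4 * Y n + X n + b) ->
  forall n, X n.+1 <= B.
Proof.
move=> a0 bB X1B X0 Ym Yp step.
(* The extra term a * X absorbs half of the dissipation into the energy, so that
   the dissipation controls both X n.+2 and X n.+1, hence the energy itself; the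
   factor 1 + a in the bound makes the conclusion uniform in the time step. *)
pose G n := 5 * X n.+1 - 4 * Y n + X n + a * X n.+1.
have GB n : G n <= (1 + a) * B.
  elim: n => [|n IH].
    (* Bounding [- 4 * Y 0] by [Yp] gives [G 0 <= 9 * X 1 + 2 * X 0 + a * X 1], whence the initial
       condition on [B]. *)
    have h : 0 <= a * (B - X 1).
      by rewrite mulr_ge0 ?(ltW a0)// subr_ge0; have := X0 1; have := X0 0; lra.
    by rewrite /G; have := Yp 0; have := X0 1; have := X0 0; lra.
  (* An energy above the bound would force dissipation [a * S] of at least [b], so the energy could
     not have grown in this step, against the induction hypothesis. *)
  rewrite leNgt; apply/negP => GB.
  suff : G n.+1 <= G n by lra.
  pose S := X n.+2 + X n.+1.
  have S0 : 0 <= S by rewrite addr_ge0.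
  have GS : G n.+1 <= (9 + a) * S.
    rewrite /G /S; have := Yp n.+1; have := mulr_ge0 (ltW a0) (X0 n.+1).
    by have := X0 n.+1; have := X0 n.+2; lra.
  have BS : a * ((1 + a) * B) <= a * ((9 + a) * S).
    by rewrite ler_pM2l//; apply: le_trans GS; exact: ltW.
  (* From [9 * b <= a * B] follows [(9 + a) * b <= a * (1 + a) * B], which [BS] bounds by
     [a * (9 + a) * S]. *)
  have bS : b <= a * S.
    have a9 : 0 < 9 + a by rewrite addr_gt0.
    rewrite -(ler_pM2l a9); have := mulr_ge0 (ltW a0) (ltW a0).
    have := ler_wpM2l (ltW a0) bB.
    have B0 : 0 <= B by have := X0 0; have := X0 1; lra.
    have := mulr_ge0 (mulr_ge0 (ltW a0) (ltW a0)) B0.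
    by lra.
  by move: bS; have := step n; rewrite /G /S; lra.
move=> n; have a1 : 0 < 1 + a by rewrite addr_gt0.
rewrite -(ler_pM2l a1); apply: le_trans (GB n).
by rewrite /G; have := Ym n; lra.
Qed.

(** * Energy balance of a single step *)

Section sav_energy.
Context {R : realType} {d : nat}.
Variable Omega : set 'rV[R]_d.
Hypothesis mO : measurable Omega.

Local Notation mu := (lebesgue_rV d).
Local Notation vL2 := (vL2 Omega).
Local Notation inner := (inner Omega).
Local Notation vgrad := (vgrad Omega).

Lemma vH10_vL2 u : vH10 Omega u -> vL2 u.
Proof. by move=> u10 i; exact: (u10 i).1.1. Qed.

Lemma innerDr (u v w : 'rV[R]_d -> 'rV[R]_d) : vL2 u -> vL2 v -> vL2 w ->
  inner w (u + v) = inner w u + inner w v.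
Proof. by move=> *; rewrite innerC innerDl// innerC (innerC _ v). Qed.

Lemma innerZr (a : R) (u w : 'rV[R]_d -> 'rV[R]_d) : vL2 u -> vL2 w ->
  inner w (a *: u) = a * inner w u.
Proof. by move=> *; rewrite innerC innerZl// innerC. Qed.

(** The expanded square of [a *: u + b *: v]. Particular coefficients give Young's inequality and
    the sign conditions on the energies. *)
Lemma inner_lin2_ge0 (a b : R) u v : vL2 u -> vL2 v ->
  0 <= a ^+ 2 * inner u u + 2 * a * b * inner u v + b ^+ 2 * inner v v.
Proof.
move=> u2 v2; have au := vL2Z a u2; have bv := vL2Z b v2.
have := inner_ge0 Omega (a *: u + b *: v).
rewrite innerDl ?innerDr ?innerZl ?innerZr//; last exact: vL2D.
by rewrite (innerC _ v u); lra.
Qed.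

Lemma vL2B (u v : 'rV[R]_d -> 'rV[R]_d) : vL2 u -> vL2 v -> vL2 (u - v).
Proof. by move=> u2 v2; rewrite -scaleN1r; apply: vL2D => //; exact: vL2Z. Qed.

Lemma innerBl (u v w : 'rV[R]_d -> 'rV[R]_d) : vL2 u -> vL2 v -> vL2 w ->
  inner (u - v) w = inner u w - inner v w.
Proof.
move=> u2 v2 w2; have Nv2 := vL2Z (-1) v2.
by rewrite -scaleN1r innerDl// innerZl// mulN1r.
Qed.

(** The expanded square of [u - 2 *: v + w], the numerical dissipation of BDF2. *)
Lemma inner_second_diff_ge0 u v w : vL2 u -> vL2 v -> vL2 w ->
  0 <= inner u u + 4 * inner v v + inner w w -
       4 * inner u v + 2 * inner u w - 4 * inner v w.
Proof.
move=> u2 v2 w2; have v22 := vL2Z (- 2) v2; have uv := vL2D u2 v22.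
have := inner_ge0 Omega (u + - 2 *: v + w).
rewrite (innerDl mO uv w2 (vL2D uv w2)) (innerDr uv w2 uv) (innerDr uv w2 w2).
rewrite (innerDl mO u2 v22 uv) (innerDr u2 v22 u2) (innerDr u2 v22 v22).
rewrite (innerDl mO u2 v22 w2) (innerDr u2 v22 w2).
rewrite !(innerZr _ v2)// !(innerZl mO _ v2)//.
by rewrite (innerC _ v u) (innerC _ w u) (innerC _ w v); lra.
Qed.

Lemma pressure_term0 p u : L2 Omega p -> vH10 Omega u -> div_free Omega u ->
  \int[mu]_(x in Omega) (p x * divergence Omega u x) = 0.
Proof.
move=> p2 u10 du; rewrite /Rintegral.
rewrite (ae_eq_integral (cst 0%E))//.
- by rewrite integral0.
- apply/measurable_EFinP; apply: measurable_funM; first exact: L2_measurable.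
  apply: measurable_sum => i.
  have := L2_measurable mO (L2_wgrad (u10 i).1 i).
  congr (measurable_fun _ _); by apply/funext => x; rewrite mxE.
- by apply: filterS du => x dx Ox /=; rewrite dx// mulr0.
Qed.

Lemma sav_step_energy (Re gamma : R) a w f u p (dq q : R) :
  sav_step Omega Re gamma a w f u p dq q ->
  inner a u + Re^-1 * inner (vgrad u) (vgrad u) + dq * q + gamma * q ^+ 2 =
  inner f u + gamma * q.
Proof.
move=> [u10 du p2 /(_ u u10)]; rewrite pressure_term0// subr0 => mom scal.
(* Only the [gamma] of the source term [gamma * q] is replaced by the scalar equation; the resulting
   [- I * q] cancels [q * I]. *)
by rewrite -mom; move: scal; set I := inner _ u => scal; rewrite -{2}scal; ring.
Qed.

(** Young's inequality spends half of each dissipation term on the forcing, [inner f u] and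
    [gamma * q]. The other half gives the decay rate. *)
Lemma sav_step_dissipation (Re gamma P N : R) a w f u p (dq q : R) :
  0 < Re -> 0 < gamma -> 0 < P ->
  inner u u <= P * inner (vgrad u) (vgrad u) ->
  vL2 f -> normL2 Omega f <= N ->
  sav_step Omega Re gamma a w f u p dq q ->
  inner a u + dq * q + Num.min (Re * P)^-1 gamma / 2 * (inner u u + q ^+ 2) <=
  (N ^+ 2 * (Re * P) + gamma) / 2.
Proof.
move=> Re0 g0 P0 poin f2 fN step.
have u2 : vL2 u by case: step => /vH10_vL2.
have := sav_step_energy step.
set D := inner (vgrad u) _ in poin *; set U := inner u u in poin *.
set al := Num.min _ _.
have RP0 : 0 < Re * P by rewrite mulr_gt0.
have aRP : al <= (Re * P)^-1 by rewrite ge_min lexx.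
have ag : al <= gamma by rewrite ge_min lexx orbT.
have diss : (Re * P)^-1 * U <= Re^-1 * D.
  have -> : Re^-1 * D = (Re * P)^-1 * (P * D) by field; rewrite !gt_eqF.
  by rewrite ler_pM2l// invr_gt0.
have fF : inner f f <= N ^+ 2.
  rewrite -(sqr_sqrtr (inner_ge0 Omega f)) ler_sqr ?nnegrE ?sqrtr_ge0//.
  by apply: le_trans fN; exact: sqrtr_ge0.
(* The square of [(Re * P) *: f - u], divided by [Re * P]. *)
have young : 2 * inner f u <= (Re * P) * N ^+ 2 + (Re * P)^-1 * U.
  have := inner_lin2_ge0 (Re * P) (-1) f2 u2.
  have RPV : 0 < (Re * P)^-1 by rewrite invr_gt0.
  have -> : (Re * P) ^+ 2 * inner f f + 2 * (Re * P) * -1 * inner f u +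
      (-1) ^+ 2 * inner u u =
      (Re * P) * ((Re * P) * inner f f - 2 * inner f u + (Re * P)^-1 * U).
    by rewrite /U; field; rewrite !gt_eqF.
  rewrite pmulr_rge0//.
  have := ler_wpM2l (ltW RP0) fF; lra.
have alU : al * U <= (Re * P)^-1 * U by rewrite ler_wpM2r// inner_ge0.
have alq : al * q ^+ 2 <= gamma * q ^+ 2 by rewrite ler_wpM2r// sqr_ge0.
have gq : 0 <= gamma * (q - 1) ^+ 2 by rewrite mulr_ge0 ?sqr_ge0 ?(ltW g0).
move=> en; nra.
Qed.

End sav_energy.

(** * Scalar algebra of the BDF1 and BDF2 steps *)

(** If the new energy exceeded the bound, dissipation would beat [be], and the energy would have to
    decrease. Arguing by contradiction keeps [k] out of the bound. *)
Lemma bdf1_energy_bound {R : realFieldType} (k al be U0 U1 I q0 q1 : R) :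
  0 < k -> 0 < al -> 0 <= be -> 0 <= U0 -> 0 <= U1 - 2 * I + U0 ->
  k^-1 * (U1 - I) + (q1 - q0) / k * q1 + al * (U1 + q1 ^+ 2) <= be ->
  U1 + q1 ^+ 2 <= U0 + q0 ^+ 2 + be / al.
Proof.
move=> k0 al0 be0 U00 UI; rewrite -(ler_pM2l k0).
have -> : k * (k^-1 * (U1 - I) + (q1 - q0) / k * q1 + al * (U1 + q1 ^+ 2)) =
    U1 - I + (q1 - q0) * q1 + k * (al * (U1 + q1 ^+ 2)).
  by field; rewrite gt_eqF.
move=> en; have q01 := sqr_ge0 (q1 - q0).
rewrite leNgt; apply/negP => lt.
have lt_be : be < al * (U1 + q1 ^+ 2).
  rewrite mulrC -ltr_pdivrMr//; apply: le_lt_trans lt.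
  by rewrite lerDr addr_ge0// sqr_ge0.
have := ltr_pM2l k0 be (al * (U1 + q1 ^+ 2)); rewrite lt_be.
have be_al : 0 <= be / al by rewrite divr_ge0// ltW.
by lra.
Qed.

(** After multiplication by [4 * k], the difference quotient tested with the new state is the
    increment of the G-norm energy plus the square of the second difference. *)
Lemma bdf2_energy_step {R : realFieldType} (k al be U0 U1 U2 I10 I20 I21 q0 q1 q2 : R) :
  0 < k -> 0 <= U2 + 4 * U1 + U0 - 4 * I21 + 2 * I20 - 4 * I10 ->
  (2 * k)^-1 * (3 * U2 - 4 * I21 + I20) + (3 * q2 - 4 * q1 + q0) / (2 * k) * q2 +
    al * (U2 + q2 ^+ 2) <= be ->
  5 * (U2 + q2 ^+ 2) - 4 * (I21 + q2 * q1) + (U1 + q1 ^+ 2) +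
    2 * (2 * k * al) * (U2 + q2 ^+ 2) <=
  5 * (U1 + q1 ^+ 2) - 4 * (I10 + q1 * q0) + (U0 + q0 ^+ 2) + 4 * k * be.
Proof.
move=> k0 UI; have k40 : 0 < 4 * k by rewrite mulr_gt0.
rewrite -(ler_pM2l k40).
have -> : 4 * k * ((2 * k)^-1 * (3 * U2 - 4 * I21 + I20) +
    (3 * q2 - 4 * q1 + q0) / (2 * k) * q2 + al * (U2 + q2 ^+ 2)) =
    2 * (3 * U2 - 4 * I21 + I20) + 2 * (3 * q2 - 4 * q1 + q0) * q2 +
    4 * k * al * (U2 + q2 ^+ 2).
  by field; rewrite gt_eqF.
by have := sqr_ge0 (q2 - 2 * q1 + q0); lra.
Qed.

(** * Bound for the scheme and the final constant *)

Lemma sav_scheme_bounded {R : realType} {d : nat} (Omega : set 'rV[R]_d)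
    (Re gamma P N k : R) u0 F u p q :
  measurable Omega -> 0 < Re -> 0 < gamma -> 0 < P -> 0 < k ->
  (forall v, vH10 Omega v ->
    inner Omega v v <= P * inner Omega (vgrad Omega v) (vgrad Omega v)) ->
  vH10 Omega u0 -> (forall t, 0 < t -> vL2 Omega (F t)) ->
  (forall t, 0 < t -> normL2 Omega (F t) <= N) ->
  sav_scheme Omega Re gamma k u0 F u p q ->
  let al := Num.min (Re * P)^-1 gamma / 2 in
  let be := (N ^+ 2 * (Re * P) + gamma) / 2 in
  forall n, inner Omega (u n.+1) (u n.+1) + q n.+1 ^+ 2 <=
    11 * (inner Omega u0 u0 + 1) + 27 * (be / al).
Proof.
move=> mO Re0 g0 P0 k0 poin u010 F2 FN [u0E q0E s1 sn] al be.
have RP0 : 0 < Re * P by rewrite mulr_gt0.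
have al0 : 0 < al by rewrite divr_gt0// lt_min invr_gt0 RP0.
have be0 : 0 <= be by rewrite divr_ge0// addr_ge0 ?(ltW g0)// mulr_ge0 ?sqr_ge0 ?(ltW RP0).
have u10 n : vH10 Omega (u n).
  by case: n => [|[|n]]; [rewrite u0E|case: s1|case: (sn n.+1 isT)].
have u2 n : vL2 Omega (u n) by exact: vH10_vL2 (u10 n).
pose X n := inner Omega (u n) (u n) + q n ^+ 2.
pose Y n := inner Omega (u n.+1) (u n) + q n.+1 * q n.
have X0 n : 0 <= X n by rewrite addr_ge0 ?sqr_ge0 ?inner_ge0.
have X0E : X 0 = inner Omega u0 u0 + 1 by rewrite /X u0E q0E expr1n.
have X1 : X 1 <= X 0 + be / al.
  have := sav_step_dissipation mO Re0 g0 P0 (poin _ (u10 1)) (F2 _ k0) (FN _ k0) s1.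
  rewrite (innerZl mO _ (vL2B (u2 1) (u2 0)) (u2 1)).
  rewrite (innerBl mO (u2 1) (u2 0) (u2 1)) (innerC _ (u 0)).
  apply: bdf1_energy_bound => //; first exact: inner_ge0.
  by have := inner_lin2_ge0 mO 1 (-1) (u2 1) (u2 0); lra.
have step n : 5 * X n.+2 - 4 * Y n.+1 + X n.+1 + 2 * (2 * k * al) * X n.+2 <=
     5 * X n.+1 - 4 * Y n + X n + 4 * k * be.
  have t0 : 0 < n.+2%:R * k by rewrite mulr_gt0.
  have := sav_step_dissipation mO Re0 g0 P0 (poin _ (u10 n.+2)) (F2 _ t0) (FN _ t0)
    (sn n.+1 isT).
  have v2 := u2 n.+2; have v1 := u2 n.+1; have v0 := u2 n.
  have w2 := vL2Z 3 v2; have w1 := vL2Z 4 v1; have w := vL2B w2 w1.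
  rewrite (innerZl mO _ (vL2D w v0) v2) (innerDl mO w v0 v2).
  rewrite (innerBl mO w2 w1 v2) (innerZl mO _ v2 v2) (innerZl mO _ v1 v2).
  rewrite (innerC _ (u n)) (innerC _ (u n.+1)).
  apply: bdf2_energy_step => //; exact: (inner_second_diff_ge0 mO v2 v1 v0).
have k2al : 0 < 2 * k * al by apply: mulr_gt0 => //; exact: mulr_gt0.
(* The bound on [X 1] makes [9 * X 1 + 2 * X 0] at most [11 * X 0 + 9 * (be / al)], and the forcing
   requires [18 * (be / al)], where [k] cancels; 27 covers both. *)
apply: (@bdf2_recursion_bounded _ X Y (2 * k * al) (4 * k * be)) => //.
- have -> : 9 * (4 * k * be) = 2 * k * al * (18 * (be / al)) by field; rewrite !gt_eqF.
  rewrite (ler_pM2l k2al) -X0E.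
  by have := divr_ge0 be0 (ltW al0); have := X0 0; lra.
- by rewrite -X0E; have := divr_ge0 be0 (ltW al0); lra.
- move=> n; have := inner_lin2_ge0 mO 2 (-1) (u2 n.+1) (u2 n).
  by have := sqr_ge0 (2 * q n.+1 - q n); rewrite /X /Y; lra.
- move=> n; have := inner_lin2_ge0 mO 2 1 (u2 n.+1) (u2 n).
  by have := sqr_ge0 (2 * q n.+1 + q n); rewrite /X /Y; lra.
Qed.

Theorem theorem2p1 (R : realType) (d : nat) (hd : d = 2%N \/ d = 3%N)
  (Omega : set 'rV[R]_d) (Omega_open : open Omega)
  (Omega_connected : connected Omega) (Omega_nonempty : Omega !=set0)
  (Omega_bounded : bounded_set Omega)
  (Re gamma : R) (Re_gt0 : 0 < Re) (gamma_gt0 : 0 < gamma) :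
  exists C : R -> R -> R,
    forall (u0 : 'rV[R]_d -> 'rV[R]_d) (F : R -> 'rV[R]_d -> 'rV[R]_d),
      vH10 Omega u0 -> div_free Omega u0 -> LinfL2 Omega F ->
      (forall t : R, 0 < t -> normL2 Omega (F t) <= norm_LinfL2 Omega F) ->
    forall (k : R) (u : nat -> 'rV[R]_d -> 'rV[R]_d)
      (p : nat -> 'rV[R]_d -> R) (q : nat -> R),
      0 < k -> sav_scheme Omega Re gamma k u0 F u p q ->
    forall n, (2 <= n)%N ->
      normL2 Omega (u n) + `|q n| <= C (normH1 Omega u0) (norm_LinfL2 Omega F).
Proof.
(* A successor dimension provides the first coordinate used for slicing. *)
have [m dE] : exists m, d = m.+1 by case: hd => ->; [exists 1%N|exists 2%N].
subst d; have [r r0 Or] := bounded_rV_box Omega_bounded.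
have mO := open_measurable_rV Omega_open.
pose P := 16 * r ^+ 2.
have P0 : 0 < P by rewrite mulr_gt0// exprn_gt0.
exists (fun N NF => 1 + (11 * (N ^+ 2 + 1) +
  27 * ((NF ^+ 2 * (Re * P) + gamma) / 2 / (Num.min (Re * P)^-1 gamma / 2)))).
move=> u0 F u010 _ [F2 _ _] FN k u p q k0 scheme [|[//|n]] // _.
have poin v := poincare_vH10 Omega_open Omega_bounded r0 (fun x Ox => Or x Ox ord0) (u := v).
have := sav_scheme_bounded mO Re_gt0 gamma_gt0 P0 k0 poin u010 F2 FN scheme n.+1.
set U := inner _ _ _; set U0 := inner _ u0 u0; set T := 27 * _ => bound.
have U0N : U0 <= normH1 Omega u0 ^+ 2.
  rewrite sqr_sqrtr ?addr_ge0 ?sqr_ge0// sqr_sqrtr ?inner_ge0//.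
  by rewrite lerDl sqr_ge0.
have nU : normL2 Omega (u n.+2) ^+ 2 = U by rewrite sqr_sqrtr// inner_ge0.
(* Each of the two terms [x] satisfies [x <= (x ^+ 2 + 1) / 2]; this is the origin of the summand 1
   in the constant. *)
have := sqr_ge0 (normL2 Omega (u n.+2) - 1); have := sqr_ge0 (`|q n.+2| - 1).
rewrite -(real_normK (num_real (q n.+2))) -nU in bound.
have := sqr_ge0 (normL2 Omega (u n.+2)); have := sqr_ge0 `|q n.+2|.
by move: bound U0N; rewrite -/(T); lra.
Qed.
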